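(* Let $(X,d,\mu)$ be a metric measure space, fix $1<p<\infty$, and set $q=p/(p-1)$. Let $R>0$, let $\{w_n\}_{1\le n\le N}$ be a finite sequence of weights ($w_n>0$), let $\{E_n\}_{1\le n\le N}$ be a sequence of measurable sets of positive measure, and let $\{U(x_n,r_n)\}_{1\le n\le N}$ be a sequence of balls in $X$ such that for $1\le n\le N$, $r_n>R$ and $E_n\subset U(x_n,r_n)$. Then $$ \left\| \sum_{1 \le n \le N}\frac{w_n \mathbf{1}_{U(x_{n}, r_{n})} }{\mu U(x_{n}, r_{n})} \right\|_{L^p (\mu)} \le \left\| M^u_{\{ R < r\}, \mu} \right\|_{L^q (\mu) \to L^q (\mu)} \left\| \sum_{1 \le n \le N}\frac{w_n \mathbf{1}_{ E_n } }{\mu E_n } \right\|_{L^p (\mu)}. $$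
   Context: A Borel measure $\mu$ on a metric space $(X,d)$ is $\tau$-additive if for every collection $\{U_\alpha\}_{\alpha\in\Lambda}$ of open sets, $\mu(\cup_\alpha U_\alpha)=\sup \mu(\cup_{i=1}^n U_{\alpha_i})$, the supremum being over all finite subcollections. A metric measure space $(X,d,\mu)$ is a metric space with a $\tau$-additive Borel measure $\mu$, not identically zero, that is finite on bounded Borel sets. Balls: $B(x,r)=\{y: d(x,y)<r\}$ and $B^{cl}(x,r)=\{y: d(x,y)\le r\}$; radii are always $>0$. $U(x,r)$ denotes a ball that may be either $B(x,r)$ or $B^{cl}(x,r)$ (collections may be mixed). The localized uncentered maximal operator is, for $g$ locally integrable and $R>0$, $$M^u_{\{R<r\},\mu} g(x) := \sup _{\{r > R,\ y\in X :\ d(x,y) < r,\ \mu B^{cl}(y, r) > 0\}} \frac{1}{\mu (B^{cl}(y, r))} \int _{B^{cl}(y, r)} |g| \, d\mu .$$ $\|M^u_{\{R<r\},\mu}\|_{L^q(\mu)\to L^q(\mu)}$ is the smallest $c\in[0,\infty]$ with $\|M^u_{\{R<r\},\mu} g\|_{L^q(\mu)}\le c\|g\|_{L^q(\mu)}$ for all $g\in L^q(\mu)$; if it is $\infty$ the inequality is understood as trivially true. *)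

(* Defs.v *)
From HB Require Import structures.
From mathcomp Require Export all_boot all_order all_algebra.
From mathcomp Require Export all_classical all_reals all_analysis.
Export Order.TTheory GRing.Theory Num.Theory.
Export numFieldNormedType.Exports.

Set Implicit Arguments.
Unset Strict Implicit.
Unset Printing Implicit Defensive.

Local Open Scope classical_set_scope.
Local Open Scope ring_scope.
Local Open Scope ereal_scope.

(* Metric spaces with a distinguished point, which [measurableType] requires.
   A space carrying a nonzero measure is nonempty, so this loses no
   generality. *)
#[short(type="pmetricType")]
HB.structure Definition PointedMetric (K : numDomainType) :=
  {M of Pointed M & Metric K M}.

Definition borelType (R : realType) (X : pmetricType R) :=
  g_sigma_algebraType (@open X).

(* The library's [closed_ball] is the topological closure of the open ball,
   in general a proper subset of this set. *)
Definition cball (R : realType) (X : pmetricType R) (x : X) (r : R) :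
    set (borelType X) :=
  [set y : X | (mdist x y <= r)%R].

Definition metric_bounded (R : realType) (X : pmetricType R) (A : set X) : Prop :=
  exists D : R, forall x y : X, A x -> A y -> (mdist x y <= D)%R.

Definition tau_additive (R : realType) (X : pmetricType R)
    (mu : set (borelType X) -> \bar R) : Prop :=
  forall (I : Type) (U : I -> set X), (forall i, open (U i)) ->
    mu (\bigcup_i U i) =
    ereal_sup [set mu (\bigcup_(i in J) U i) | J in @finite_set I].

Definition metric_measure_space (R : realType) (X : pmetricType R)
    (mu : {measure set (borelType X) -> \bar R}) : Prop :=
  [/\ tau_additive mu,
      mu setT != 0 &
      forall A : set (borelType X),
        measurable A -> metric_bounded (A : set X) -> mu A < +oo].

(* When [mu] is a metric measure space, the index set of the supremum is never
   empty (balls of large radius have positive measure), and the denominators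
   are positive and finite. *)
Definition local_maximal (R : realType) (X : pmetricType R)
    (mu : {measure set (borelType X) -> \bar R}) (rho : R)
    (g : borelType X -> R) (x : borelType X) : \bar R :=
  ereal_sup
    [set (\int[mu]_(z in cball yr.1 yr.2) `|g z|%:E) / mu (cball yr.1 yr.2)
    | yr in [set yr : X * R |
        [/\ (rho < yr.2)%R,
            (mdist (x : X) yr.1 < yr.2)%R &
            0 < mu (cball yr.1 yr.2)]]].

(* The value is [+oo] when no finite constant works. *)
Definition Lnorm_op (d : measure_display) (T : measurableType d) (R : realType)
    (mu : {measure set T -> \bar R}) (q : R)
    (M : (T -> R) -> T -> \bar R) : \bar R :=
  ereal_inf
    [set c : \bar R | 0 <= c /\
      forall g : T -> R, g \in Lfun mu q%:E ->
        'N[mu]_(q%:E)[M g] <= c * 'N[mu]_(q%:E)[EFin \o g]].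

Definition weighted_average (d : measure_display) (T : measurableType d)
    (R : realType) (mu : {measure set T -> \bar R}) (N : nat) (w : 'I_N -> R)
    (A : 'I_N -> set T) (x : T) : \bar R :=
  \sum_(n < N) (w n * \1_(A n) x)%:E / mu (A n).

(* Main.v *)
Require Import Defs.
From mathcomp Require Import measurable_realfun.
From mathcomp Require Import ring.

Local Open Scope classical_set_scope.
Local Open Scope ring_scope.
Local Open Scope ereal_scope.

Set Implicit Arguments.
Unset Strict Implicit.
Unset Printing Implicit Defensive.

(** The inequality follows by duality from a pointwise bound on averages.

    Write f for the weighted average over the balls U n, h for the one over
    the sets E n, and take g = f ^ (p - 1), so that g ^ q = f ^ p. Expanding
    one factor f of f ^ p = f * g gives
      int f ^ p = sum_n (w n / mu (U n)) * int_(U n) g = sum_n w n * a n,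
    where a n is the mean of g over U n. If a n <= M g on E n, then a n is at
    most the mean of M g over E n, hence
      int f ^ p <= int h * M g <= |h|_p * |M g|_q
                <= |M|_(q -> q) * |h|_p * |f|_p ^ (p - 1),
    and dividing by the finite quantity |f|_p ^ (p - 1) concludes. This part,
    [Lnorm_weighted_average_le], holds on any measure space and for any
    operator M that dominates the means over the U n at the points of E n.
    Since M g may take infinite values and may fail to be measurable, Hoelder's
    inequality is applied to the simple function max_n (a n * 1_(E n)), which
    lies below |M g|.

    For the localized maximal operator the domination at a point y of a ball
    is [average_le_local_maximal]. The operator only sees the closed balls that
    have y at distance from the center strictly less than the radius, so a
    ball with y in it is reached by approximation: an open ball is the
    increasing union of smaller such closed balls, and a closed ball is the
    decreasing intersection of larger ones. The condition that the radius
    exceeds rho is strict, hence survives in both approximations. *)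

(** * Monotonicity of integrals and norms *)

Section monotone.
Context d (T : measurableType d) (R : realType).
Variable mu : {measure set T -> \bar R}.

(** The integral of a nonnegative function is a supremum over the simple
    functions below it, which is monotone whether or not the two functions are
    measurable. *)
Lemma ge0_le_integral_nonmeasurable (f g : T -> \bar R) :
  (forall x, 0 <= f x) -> (forall x, f x <= g x) ->
  \int[mu]_x f x <= \int[mu]_x g x.
Proof.
move=> f0 fg; have g0 x : 0 <= g x by exact: le_trans (f0 x) (fg x).
rewrite !ge0_integralTE//; apply: ereal_sup_le => _ [h /= hf <-].
by exists h => //= x; exact: le_trans (hf x) (fg x).
Qed.

Lemma le_Lnorm (p : R) (f g : T -> \bar R) : (0 < p)%R ->
  (forall x, `|f x| <= `|g x|) -> 'N[mu]_p%:E[f] <= 'N[mu]_p%:E[g].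
Proof.
move=> p0 fg; rewrite unlock.
apply: gt0_ler_poweR; rewrite ?invr_ge0 ?(ltW p0)//.
- by rewrite in_itv/= leey andbT integral_ge0// => x _; exact: poweR_ge0.
- by rewrite in_itv/= leey andbT integral_ge0// => x _; exact: poweR_ge0.
apply: ge0_le_integral_nonmeasurable => x; first exact: poweR_ge0.
apply: gt0_ler_poweR; rewrite ?(ltW p0) ?in_itv/= ?leey ?abse_ge0//.
Qed.
End monotone.

(** * Linear combinations of indicators *)

Definition step_fun (T : Type) (R : realType) (N : nat) (c : 'I_N -> R)
    (A : 'I_N -> set T) (x : T) : R :=
  (\sum_(n < N) c n * \1_(A n) x)%R.

Section step.
Context d (T : measurableType d) (R : realType).
Variable mu : {measure set T -> \bar R}.
Variables (N : nat) (c : 'I_N -> R) (A : 'I_N -> set T).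
Hypothesis c0 : forall n, (0 <= c n)%R.
Hypothesis mA : forall n, measurable (A n).
Hypothesis muA : forall n, mu (A n) < +oo.

Lemma step_fun_ge0 x : (0 <= step_fun c A x)%R.
Proof. by apply: sumr_ge0 => n _; rewrite mulr_ge0. Qed.

Lemma step_fun_le x : (step_fun c A x <= \sum_(n < N) c n)%R.
Proof.
apply: ler_sum => n _; rewrite indicE -[leRHS]mulr1 ler_wpM2l//.
by case: (_ \in _).
Qed.

Lemma measurable_step_fun : measurable_fun setT (step_fun c A).
Proof.
by apply: measurable_sum => n; exact: measurable_funM.
Qed.

Lemma ge0_integral_step_funM (g : T -> R) :
  measurable_fun setT g -> (forall x, 0 <= g x)%R ->
  \int[mu]_x (step_fun c A x * g x)%:E =
  \sum_(n < N) (c n)%:E * \int[mu]_(x in A n) (g x)%:E.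
Proof.
move=> mg g0.
have mgA n : measurable_fun (A n) (EFin \o g).
  by apply/measurable_EFinP; exact: measurable_funTS.
have mc n : measurable_fun setT ((EFin \o g) \_ (A n)).
  exact/(measurable_restrictT _ _).1.
have gA0 n x : 0 <= ((EFin \o g) \_ (A n)) x.
  by apply: erestrict_ge0 => y _; rewrite lee_fin.
transitivity (\int[mu]_x \sum_(n < N) (c n)%:E * ((EFin \o g) \_ (A n)) x).
  apply: eq_integral => x _; rewrite mulr_suml -sumEFin; apply: eq_bigr => n _.
  by rewrite epatch_indic/= -EFinM; congr EFin; rewrite -mulrA (mulrC (g x)).
rewrite ge0_integral_sum//; last 2 first.
- by move=> n; apply: measurable_funeM.
- by move=> n x _; rewrite mule_ge0// lee_fin.
by apply: eq_bigr => n _; rewrite ge0_integralZl_EFin// -integral_mkcond.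
Qed.

(** The dual function is bounded, by a power of the sum of the coefficients. *)
Lemma integral_powR_step_fun_lty (p : R) n : (1 < p)%R ->
  \int[mu]_(x in A n) (step_fun c A x `^ (p - 1))%:E < +oo.
Proof.
move=> p1; apply: (@le_lt_trans _ _
    (\int[mu]_(x in A n) cst ((\sum_(n < N) c n) `^ (p - 1))%:E x)); last first.
  by rewrite integral_cst// lte_mul_pinfty// lee_fin powR_ge0.
apply: ge0_le_integral => //.
- by move=> x _; rewrite lee_fin powR_ge0.
- apply/measurable_EFinP/measurable_funTS.
  by apply: (measurableT_comp (measurable_powR _)); exact: measurable_step_fun.
- move=> x _; rewrite lee_fin ge0_ler_powR//.
  + by rewrite subr_ge0 ltW.
  + by rewrite nnegrE step_fun_ge0.
  + by rewrite nnegrE sumr_ge0.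
  + exact: step_fun_le.
Qed.

(** Splitting f ^ p as f * f ^ (p - 1) and expanding the first factor only: the
    p-th power of the norm becomes a combination of integrals of the dual
    function f ^ (p - 1) over the sets A n. *)
Lemma integral_step_fun_powR (p : R) : (1 < p)%R ->
  \int[mu]_x (step_fun c A x `^ p)%:E =
  \sum_(n < N) (c n)%:E * \int[mu]_(x in A n) (step_fun c A x `^ (p - 1))%:E.
Proof.
move=> p1; rewrite -(ge0_integral_step_funM (g := fun x => (_ `^ _)%R))//.
- by apply: eq_integral => x _; rewrite mulr_powRB1 ?step_fun_ge0// (lt_trans ltr01).
- by apply: (measurableT_comp (measurable_powR _)); exact: measurable_step_fun.
- by move=> x; exact: powR_ge0.
Qed.

Lemma integral_step_fun_powR_lty (p : R) : (1 < p)%R ->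
  \int[mu]_x (step_fun c A x `^ p)%:E < +oo.
Proof.
move=> p1; rewrite integral_step_fun_powR//; apply: lte_sum_pinfty => n _.
by rewrite lte_mul_pinfty// ?lee_fin// integral_powR_step_fun_lty.
Qed.

Lemma Lnorm_step_fun (p : R) :
  'N[mu]_p%:E[EFin \o step_fun c A] =
  (\int[mu]_x (step_fun c A x `^ p)%:E) `^ p^-1.
Proof.
rewrite unlock; congr (_ `^ _); apply: eq_integral => x _ /=.
by rewrite ger0_norm// step_fun_ge0.
Qed.

End step.

(** * Duality *)

Section average.
Context d (T : measurableType d) (R : realType).
Variable mu : {measure set T -> \bar R}.

Lemma weighted_averageE (N : nat) (w : 'I_N -> R) (A : 'I_N -> set T) :
  (forall n, 0 < mu (A n) < +oo) ->
  weighted_average mu w A =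
  EFin \o step_fun (fun n => w n / fine (mu (A n)))%R A.
Proof.
move=> muA; apply/funext => x; rewrite /weighted_average /= /step_fun -sumEFin.
apply: eq_bigr => n _; have /andP[A0 Aoo] := muA n.
rewrite -[X in _ / X]fineK ?ge0_fin_numE//.
by rewrite inver gt_eqF ?fine_gt0 ?A0//= -EFinM mulrAC.
Qed.
End average.

Section duality.
Context d (T : measurableType d) (R : realType).
Variable mu : {measure set T -> \bar R}.

Lemma measurable_bigmaxr (I : Type) (s : seq I) (h : I -> T -> R) :
  (forall i, measurable_fun setT (h i)) ->
  measurable_fun setT (fun x => \big[Num.max/0%R]_(i <- s) h i x).
Proof.
move=> mh; elim: s => [|i s ih].
  by under eq_fun do rewrite big_nil; exact: measurable_cst.
by under eq_fun do rewrite big_cons; exact: measurable_maxr.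
Qed.

(** The duality argument. The operator M need only dominate, on each E n, the
    mean over U n of a given function; it is used at f ^ (p - 1), where f is the
    weighted average over the U n. *)
Lemma Lnorm_weighted_average_le (M : (T -> R) -> T -> \bar R) (p q : R)
    (N : nat) (w : 'I_N -> R) (E U : 'I_N -> set T) :
  (1 < p)%R -> q = (p / (p - 1))%R -> (forall n, 0 < w n)%R ->
  (forall n, measurable (E n)) -> (forall n, 0 < mu (E n) < +oo) ->
  (forall n, measurable (U n)) -> (forall n, 0 < mu (U n) < +oo) ->
  (forall (g : T -> R) n y, measurable_fun setT g -> E n y ->
    (\int[mu]_(z in U n) `|g z|%:E) / mu (U n) <= M g y) ->
  'N[mu]_p%:E[weighted_average mu w U] <=
  Lnorm_op mu q M * 'N[mu]_p%:E[weighted_average mu w E].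
Proof.
move=> p1 qE w0 mE muE mU muU avgM.
have p0 : (0 < p)%R by exact: lt_trans p1.
have p10 : (0 < p - 1)%R by rewrite subr_gt0.
have q0 : (0 < q)%R by rewrite qE divr_gt0.
have pq : (p^-1 + q^-1 = 1)%R.
  by rewrite qE invf_div -[X in (X + _)%R]mul1r -mulrDl addrC subrK divff ?gt_eqF.
have pqM : ((p - 1) * q = p)%R by rewrite qE mulrCA divff ?mulr1 ?gt_eqF.
rewrite !weighted_averageE//.
set cU := (X in step_fun X U); set cE := (X in step_fun X E).
have c_ge0 (A : 'I_N -> set T) n : (0 <= w n / fine (mu (A n)))%R.
  by apply: divr_ge0; [exact: ltW|exact: fine_ge0].
have cU0 n : (0 <= cU n)%R by exact: c_ge0.
have cE0 n : (0 <= cE n)%R by exact: c_ge0.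
set f := step_fun cU U; set h := step_fun cE E.
have Eoo n : mu (E n) < +oo by case/andP: (muE n).
have Uoo n : mu (U n) < +oo by case/andP: (muU n).
have f0 x : (0 <= f x)%R by exact: step_fun_ge0.
have h0 x : (0 <= h x)%R by exact: step_fun_ge0.
have mf : measurable_fun setT f by exact: measurable_step_fun.
have mh : measurable_fun setT h by exact: measurable_step_fun.
have Foo : \int[mu]_x (f x `^ p)%:E < +oo.
  exact: integral_step_fun_powR_lty.
have F0 : 0 <= \int[mu]_x (f x `^ p)%:E.
  by apply: integral_ge0 => x _; rewrite lee_fin powR_ge0.
have Ffin : \int[mu]_x (f x `^ p)%:E \is a fin_num by rewrite ge0_fin_numE.
have FE := fineK Ffin.
(* The last step divides by the norm of f, so f = 0 is treated apart. *)
have [F_eq0|F_neq0] := eqVneq (\int[mu]_x (f x `^ p)%:E) 0.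
  rewrite Lnorm_step_fun//.
  rewrite F_eq0 poweR0r ?invr_neq0 ?gt_eqF// mule_ge0 ?Lnorm_ge0//.
  by apply: le_ereal_inf_tmp => c [].
pose g x := (f x `^ (p - 1))%R.
have g0 x : (0 <= g x)%R by exact: powR_ge0.
have mg : measurable_fun setT g by exact: (measurableT_comp (measurable_powR _)).
have gU n : \int[mu]_(x in U n) (g x)%:E \is a fin_num.
  rewrite ge0_fin_numE; last by apply: integral_ge0 => x _; rewrite lee_fin.
  exact: integral_powR_step_fun_lty.
(* The means of g over the U n, and the simple function of these means that
   stands for M g in the inequality of Hoelder. *)
pose a n : R := (fine (\int[mu]_(x in U n) (g x)%:E) / fine (mu (U n)))%R.
have a0 n : (0 <= a n)%R.
  by rewrite divr_ge0 ?fine_ge0// integral_ge0// => x _; rewrite lee_fin.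
have aM n y : E n y -> (a n)%:E <= M g y.
  move=> Eny; apply: le_trans (avgM g n y mg Eny).
  have /andP[Un0 _] := muU n.
  under [in leRHS]eq_integral do rewrite ger0_norm//.
  rewrite -[X in _ <= X / _]fineK// -[X in _ / X]fineK ?ge0_fin_numE//.
  by rewrite inver gt_eqF ?fine_gt0 ?Un0//=.
pose phi x : R := \big[Num.max/0%R]_(n < N) (a n * \1_(E n) x)%R.
have phi0 x : (0 <= phi x)%R by exact: bigmax_ge_id.
have mphi : measurable_fun setT phi.
  by apply: measurable_bigmaxr => n; exact: measurable_funM.
have phiE n x : E n x -> (a n <= phi x)%R.
  move=> Enx; rewrite -[leLHS]mulr1 -[X in (a n * X)%R](_ : \1_(E n) x = 1%R).
    exact: (le_bigmax_cond _ (fun n => (a n * \1_(E n) x)%R)).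
  by rewrite indicE mem_set.
have phiM x : `|(phi x)%:E| <= `|M g x|.
  rewrite gee0_abs ?lee_fin//.
  rewrite /phi; elim/big_ind : _ => [|u v|n _]; first exact: abse_ge0.
    by move=> uM vM; rewrite EFin_max ge_max uM.
  rewrite indicE; case: (boolP (x \in E n)) => [/set_mem Enx|_].
    by rewrite mulr1 (le_trans (aM n x Enx))// lee_abs.
  by rewrite mulr0 abse_ge0.
(* The term of index n is w n * a n on the left; on the right it is at least
   the same quantity, since phi is at least a n on E n. *)
have Fle : \int[mu]_x (f x `^ p)%:E <=
    'N[mu]_p%:E[EFin \o h] * 'N[mu]_q%:E[EFin \o phi].
  apply: le_trans (hoelder mu mh mphi p0 q0 pq).
  rewrite Lnorm1 integral_step_fun_powR//.
  under [leRHS]eq_integral do rewrite /= ger0_norm ?mulr_ge0//.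
  rewrite ge0_integral_step_funM//.
  apply: lee_sum => n _.
  have /andP[Un0 _] := muU n; have /andP[En0 _] := muE n.
  have Un : mu (U n) \is a fin_num by rewrite ge0_fin_numE.
  have En : mu (E n) \is a fin_num by rewrite ge0_fin_numE.
  rewrite [leLHS](_ : _ = (cE n)%:E * \int[mu]_(x in E n) cst (a n)%:E x).
    apply: lee_wpmul2l; first by rewrite lee_fin cE0.
    apply: ge0_le_integral => //.
    - by move=> x _; rewrite lee_fin.
    - by apply/measurable_EFinP; exact: measurable_funTS.
    - by move=> x Enx; rewrite lee_fin phiE.
  rewrite integral_cst// -(fineK (gU n)) -[X in _ = _ * (_ * X)]fineK//.
  rewrite -!EFinM; congr EFin; rewrite /cU /cE /a; field.
  by rewrite !gt_eqF ?fine_gt0 ?muU ?muE.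
set F := fine (\int[mu]_x (f x `^ p)%:E) in FE.
have F_gt0 : (0 < F)%R by rewrite fine_gt0// lt0e F_neq0 F0.
have NfE : 'N[mu]_p%:E[EFin \o f] = (F `^ p^-1)%:E.
  by rewrite Lnorm_step_fun -?FE//.
have NgE : 'N[mu]_q%:E[EFin \o g] = (F `^ q^-1)%:E.
  rewrite -poweR_EFin FE unlock; congr (_ `^ _); apply: eq_integral => x _.
  by rewrite /= ger0_norm// -powRrM pqM.
have gL : g \in Lfun mu q%:E.
  rewrite inE; apply/andP; split; rewrite inE//.
  by rewrite /= /finite_norm NgE ltry.
have Nh_fin : 'N[mu]_p%:E[EFin \o h] \is a fin_num.
  rewrite ge0_fin_numE ?Lnorm_ge0// Lnorm_step_fun//.
  by rewrite poweR_lty// integral_step_fun_powR_lty//.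
(* A zero norm would make the integral of f ^ p vanish, by the bound above. *)
have Nh0 : 0 < 'N[mu]_p%:E[EFin \o h].
  rewrite lt0e Lnorm_ge0 andbT; apply/eqP => Nh0.
  by move: Fle; rewrite Nh0 mul0e -FE lee_fin leNgt F_gt0.
(* The norm of h is positive and finite, so multiplying by it commutes with the
   infimum that defines the operator norm. *)
rewrite -(fineK Nh_fin) muleC -ereal_inf_pZl; last first.
  by rewrite fine_gt0// Nh0 -ge0_fin_numE ?Lnorm_ge0.
apply: le_ereal_inf_tmp => _ [c [c0 Mc] <-].
rewrite fineK// muleC.
(* Multiply by |g|_q = F ^ (1 / q), which turns |f|_p = F ^ (1 / p) into F. *)
have Fq0 : (0 < F `^ q^-1)%R by rewrite powR_gt0.
rewrite -(@lee_pmul2r _ (F `^ q^-1)%:E)// NfE -EFinM -powRD; last first.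
  by apply/implyP => _; rewrite gt_eqF.
rewrite pq powRr1 ?(ltW F_gt0)// FE (le_trans Fle)//.
rewrite -muleA muleCA lee_wpmul2l ?Lnorm_ge0//.
by rewrite -NgE (le_trans _ (Mc g gL))// le_Lnorm.
Qed.
End duality.

(** * Balls of a metric space *)

Section metric.
Context (R : realType) (X : pmetricType R).
Local Open Scope ring_scope.

Lemma open_mball (x : X) (r : R) : open (ball x r).
Proof.
rewrite openE => y; rewrite ballEmdist/= => xyr.
apply/nbhs_ballP; exists (r - mdist x y) => /=; first by rewrite subr_gt0.
move=> z; rewrite !ballEmdist/= => yz.
by rewrite (le_lt_trans (metric_triangle x y z))// -ltrBrDl.
Qed.

Lemma open_setC_cball (x : X) (r : R) : open (~` (cball x r : set X)).
Proof.
rewrite openE => y /= /negP; rewrite -ltNge => rxy.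
apply/nbhs_ballP; exists (mdist x y - r) => /=; first by rewrite subr_gt0.
move=> z; rewrite ballEmdist/= => yz; apply/negP; rewrite -ltNge.
have := metric_triangle x z y; rewrite (metric_sym z y) => xzy.
by rewrite -(ltrD2r (mdist y z)) (lt_le_trans _ xzy)// -ltrBrDl.
Qed.

Lemma borel_measurable_open (A : set X) :
  open A -> measurable (A : set (borelType X)).
Proof. by move=> oA; exact: sub_sigma_algebra. Qed.

Lemma measurable_mball (x : X) (r : R) :
  measurable (ball x r : set (borelType X)).
Proof. exact: (borel_measurable_open (@open_mball x r)). Qed.

Lemma measurable_cball (x : X) (r : R) : measurable (cball x r).
Proof.
rewrite -[cball x r]setCK; apply: measurableC.
exact: (borel_measurable_open (@open_setC_cball x r)).
Qed.

Lemma metric_bounded_cball (x : X) (r : R) : metric_bounded (cball x r : set X).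
Proof.
exists (r + r) => y z; rewrite /cball/= => xy xz.
by rewrite (le_trans (metric_triangle y x z))// (metric_sym y) lerD.
Qed.

Lemma le_cball (x : X) (r s : R) : r <= s -> cball x r `<=` cball x s.
Proof. by move=> rs y /= /le_trans; apply. Qed.

Lemma ball_bigcup_cball (x : X) (r e : R) : 0 < e ->
  (ball x r : set (borelType X)) = \bigcup_k cball x (r - e / k.+1%:R).
Proof.
move=> e0; apply/seteqP; split => [y|y [k _]]; rewrite ballEmdist /cball/=.
  move=> xyr.
  have d0 : 0 < r - mdist x y by rewrite subr_gt0.
  have [k _ ek] := near_infty_natSinv_lt (PosNum (divr_gt0 d0 e0)).
  exists k => //=; rewrite lerBrDr -lerBrDl; have /= := ek k (leqnn _).
  by rewrite ltr_pdivlMr// mulrC => /ltW.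
by move=> xy; rewrite (le_lt_trans xy)// ltrBlDr ltrDl divr_gt0.
Qed.

Lemma cball_bigcap_cball (x : X) (r : R) :
  cball x r = \bigcap_k cball x (r + k.+1%:R^-1).
Proof.
apply/seteqP; split => [y xy k _|y xy].
  by apply: le_cball xy; rewrite lerDl.
rewrite /cball/=; apply/ler_addgt0Pr => e e0.
have [k _ ek] := near_infty_natSinv_lt (PosNum e0).
apply: (le_trans (xy k I)); rewrite lerD2l.
by apply/ltW; exact: (ek k (leqnn _)).
Qed.
End metric.

(** * Averages over balls and the localized maximal operator *)

Section local_maximal.
Context (R : realType) (X : pmetricType R).
Variables (mu : {measure set (borelType X) -> \bar R}).
Hypothesis mu_cball : forall (x : X) r, mu (cball x r) < +oo.
Variables (rho : R) (g : borelType X -> R).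
Hypothesis mg : measurable_fun setT g.

(** The inequality between products also covers balls of measure zero, for which
    no quotient enters the supremum. *)
Lemma integral_cball_le_local_maximal_lt (x : X) (s : R) (y : X) :
  (rho < s)%R -> (mdist y x < s)%R ->
  \int[mu]_(z in cball x s) `|g z|%:E <=
  local_maximal mu rho g y * mu (cball x s).
Proof.
move=> rs yxs; have mB := measurable_cball x s.
have mgB : measurable_fun (cball x s) (fun z => `|g z|%:E).
  by apply/measurable_EFinP; apply: measurableT_comp => //; exact: measurable_funTS.
have [B0|B0] := eqVneq (mu (cball x s)) 0.
  rewrite B0 mule0 null_set_integral//.
have {}B0 : 0 < mu (cball x s) by rewrite lt0e B0 measure_ge0.
have Bfin : mu (cball x s) \is a fin_num by rewrite ge0_fin_numE.
have bpos : (0 < fine (mu (cball x s)))%R by rewrite fine_gt0// B0 mu_cball.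
rewrite -[X in _ * X]fineK// -lee_pdivrMr//.
apply: ereal_sup_ubound; exists (x, s) => //=.
by rewrite -[X in _ / X]fineK// inver gt_eqF.
Qed.

(** Enlarging the radius puts y at distance less than the radius from the
    center, and the larger ball still has positive measure: the supremum has a
    nonnegative member. *)
Lemma local_maximal_ge0 (x : X) (r : R) (y : X) :
  (rho < r)%R -> cball x r y -> 0 < mu (cball x r) ->
  0 <= local_maximal mu rho g y.
Proof.
move=> rhor xy B0; have rr1 : (r < r + 1)%R by rewrite ltrDl.
have mB := measurable_cball x (r + 1).
apply: le_ereal_sup_tmp; exists
  ((\int[mu]_(z in cball x (r + 1)) `|g z|%:E) / mu (cball x (r + 1))).
  exists (x, r + 1)%R => //=; split.
  - exact: lt_trans rr1.
  - by rewrite metric_sym (le_lt_trans xy).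
  - rewrite (lt_le_trans B0)// le_measure ?inE//; first exact: measurable_cball.
    exact/le_cball/ltW.
by apply: mule_ge0; [exact: integral_ge0|rewrite inve_ge0].
Qed.

(** The closed balls of radii increasing to r exhaust the open ball, and the
    integral is continuous along their union. *)
Lemma integral_ball_le_local_maximal (x : X) (r : R) (y : X) :
  (rho < r)%R -> ball x r y -> 0 <= local_maximal mu rho g y ->
  \int[mu]_(z in ball x r) `|g z|%:E <=
  local_maximal mu rho g y * mu (ball x r).
Proof.
move=> rhor yB S0.
have xyr : (mdist x y < r)%R by move: yB; rewrite ballEmdist.
(* Half of this margin keeps the radii r - e / 2 / k.+1 above both rho and the
   distance to y. *)
pose e := (r - Num.max rho (mdist x y))%R.
have e0 : (0 < e)%R by rewrite subr_gt0 gt_max rhor.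
have e20 : (0 < e / 2)%R by rewrite divr_gt0.
have mb := measurable_mball x r.
have sub k : cball x (r - e / 2 / k.+1%:R) `<=` (ball x r : set (borelType X)).
  by rewrite (ball_bigcup_cball x r e20) => z zk; exists k.
have mgA (A : set (borelType X)) : measurable_fun A (fun z => `|g z|%:E).
  by apply/measurable_EFinP; apply: measurableT_comp => //; exact: measurable_funTS.
have nd : nondecreasing_seq (fun k => cball x (r - e / 2 / k.+1%:R)).
  move=> k l kl; apply/subsetPset/le_cball; rewrite lerD2l lerN2 ler_pM2l//.
  by rewrite lef_pV2 ?posrE// ler_nat.
have := ge0_nondecreasing_set_cvg_integral (mu := mu) nd
  (fun k => measurable_cball x _) (fun k => mgA _) (fun _ _ _ => normr_ge0 _).
rewrite -(ball_bigcup_cball x r e20) => cv.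
apply: (cvge_le _ cv); apply: nearW => k.
have hk : (e / 2 / k.+1%:R < e)%R.
  rewrite ltr_pdivrMr// ltr_pdivrMr// -mulrA ltr_pMr// -natrM ltr1n.
  by rewrite mulSn addSn.
have : (Num.max rho (mdist x y) < r - e / 2 / k.+1%:R)%R.
  by rewrite ltrBrDr -ltrBrDl.
rewrite gt_max metric_sym => /andP[h1 h2].
apply: le_trans (integral_cball_le_local_maximal_lt h1 h2) _.
by rewrite lee_wpmul2l// le_measure ?inE//; exact: measurable_cball.
Qed.

(** Here y may lie at distance exactly r from the center. The closed balls of
    radii decreasing to r see y, contain the given ball, and have measures that
    converge to its measure since they are finite. *)
Lemma integral_cball_le_local_maximal (x : X) (r : R) (y : X) :
  (rho < r)%R -> cball x r y -> 0 < mu (cball x r) ->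
  \int[mu]_(z in cball x r) `|g z|%:E <=
  local_maximal mu rho g y * mu (cball x r).
Proof.
move=> rhor xyr B0; have S0 := local_maximal_ge0 rhor xyr B0.
have mgA (A : set (borelType X)) : measurable_fun A (fun z => `|g z|%:E).
  by apply/measurable_EFinP; apply: measurableT_comp => //; exact: measurable_funTS.
have mB := measurable_cball x.
have [->|Sy] := eqVneq (local_maximal mu rho g y) +oo.
  by rewrite gt0_mulye// leey.
have Sfin : local_maximal mu rho g y \is a fin_num.
  by rewrite ge0_fin_numE// ltey.
have ni : nonincreasing_seq (fun k => cball x (r + k.+1%:R^-1)).
  move=> k l kl; apply/subsetPset/le_cball; rewrite lerD2l.
  by rewrite lef_pV2 ?posrE// ler_nat.
have := @nonincreasing_cvg_mu _ _ _ mu (fun k => cball x (r + k.+1%:R^-1))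
  (mu_cball _ _) (fun k => mB _).
rewrite -cball_bigcap_cball => /(_ (mB _) ni) cv.
apply: (cvge_ge _ (cvgeZl Sfin cv)); apply: nearW => k /=.
have rk : (r < r + k.+1%:R^-1)%R by rewrite ltrDl.
apply: le_trans (integral_cball_le_local_maximal_lt _ _).
- apply: ge0_subset_integral => //.
  exact/le_cball/ltW.
- exact: lt_trans rk.
- by rewrite metric_sym (le_lt_trans xyr).
Qed.

(** The pointwise domination that the duality argument takes as input. *)
Lemma average_le_local_maximal (U : set (borelType X)) (x : X) (r : R) (y : X) :
  U = ball x r \/ U = cball x r -> (rho < r)%R -> 0 < mu U -> U y ->
  (\int[mu]_(z in U) `|g z|%:E) / mu U <= local_maximal mu rho g y.
Proof.
move=> UE rhor U0 Uy.
have mU : measurable U.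
  by case: UE => ->; [exact: measurable_mball|exact: measurable_cball].
have Ucball : U `<=` cball x r.
  by case: UE => -> // z; rewrite ballEmdist => /ltW.
have muU : mu U <= mu (cball x r).
  by rewrite le_measure ?inE//; exact: measurable_cball.
have Uoo : mu U < +oo by exact: le_lt_trans muU (mu_cball _ _).
have S0 := local_maximal_ge0 rhor (Ucball _ Uy) (lt_le_trans U0 muU).
have Ufin : mu U \is a fin_num by rewrite ge0_fin_numE.
have u0 : (0 < fine (mu U))%R by rewrite fine_gt0// U0.
rewrite -[X in _ / X]fineK// inver gt_eqF// lee_pdivrMr// fineK//.
case: UE => UE; subst U; first exact: integral_ball_le_local_maximal.
exact: integral_cball_le_local_maximal.
Qed.
End local_maximal.

(** * The weighted inequality *)

Theorem theorem3p6 (R : realType) (X : pmetricType R)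
    (mu : {measure set (borelType X) -> \bar R})
    (p q rho : R) (N : nat) (w : 'I_N -> R) (E : 'I_N -> set (borelType X))
    (U : 'I_N -> set (borelType X)) (x : 'I_N -> X) (r : 'I_N -> R) :
  metric_measure_space mu ->
  (1 < p)%R -> q = (p / (p - 1))%R ->
  (0 < rho)%R ->
  (forall n, (0 < w n)%R) ->
  (forall n, measurable (E n) /\ 0 < mu (E n)) ->
  (forall n, U n = ball (x n) (r n) \/ U n = cball (x n) (r n)) ->
  (forall n, (rho < r n)%R /\ E n `<=` U n) ->
  'N[mu]_(p%:E)[weighted_average mu w U] <=
  Lnorm_op mu q (local_maximal mu rho) *
  'N[mu]_(p%:E)[weighted_average mu w E].
Proof.
move=> [_ _ mu_fin] p1 qE _ w0 mE UE rE.
have mu_cball (z : X) (s : R) : mu (cball z s) < +oo.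
  exact: mu_fin (measurable_cball z s) (@metric_bounded_cball _ _ z s).
have mU n : measurable (U n).
  by case: (UE n) => ->; [exact: measurable_mball|exact: measurable_cball].
have Ucball n : U n `<=` cball (x n) (r n).
  by case: (UE n) => -> // z; rewrite ballEmdist => /ltW.
have muU n : mu (U n) < +oo.
  apply: le_lt_trans (mu_cball (x n) (r n)).
  by rewrite le_measure ?inE//; exact: measurable_cball.
have muEU n : mu (E n) <= mu (U n).
  by rewrite le_measure ?inE//; [exact: (mE n).1|exact: (rE n).2].
apply: Lnorm_weighted_average_le => //.
- by move=> n; exact: (mE n).1.
- by move=> n; rewrite (mE n).2 (le_lt_trans (muEU n)).
- by move=> n; rewrite muU (lt_le_trans (mE n).2).
- move=> g n y mg Eny; have [rhor EU] := rE n.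
  apply: (average_le_local_maximal mu_cball mg (UE n)) => //.
  + exact: lt_le_trans (mE n).2 (muEU n).
  + exact: EU.
Qed.
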